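(* Let $\mathcal{H}$ be a complex separable infinite-dimensional Hilbert space and let $T$ be a bounded linear operator on $\mathcal{H}$. There exists an at most countable set of vectors $\{v_i\}_{i\in I}\subseteq\mathcal{H}$ such that $\{T^nv_i\}_{i\in I,\,n\geqslant0}$ is a Parseval frame in $\mathcal{H}$ if and only if $\|T\|\leqslant1$ and $(T^* )^nv\to0$ as $n\to+\infty$ for all $v\in\mathcal{H}$.
   Context: A countable family $\{x_k\}_{k}$ in a Hilbert space $\mathcal{H}$ is a frame of $\mathcal{H}$ if there are constants $A,B>0$ with $A\|x\|^2\leqslant\sum_k|\langle x,x_k\rangle|^2\leqslant B\|x\|^2$ for all $x\in\mathcal{H}$; it is a Parseval frame if one can take $A=B=1$. *)

(* Defs.v *)
From HB Require Import structures.
From mathcomp Require Import all_boot all_order all_algebra.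
From mathcomp Require Import complex sesquilinear.
From mathcomp Require Import all_classical all_reals all_analysis.

Set Implicit Arguments.
Unset Strict Implicit.
Unset Printing Implicit Defensive.

Import Order.TTheory GRing.Theory Num.Theory.
Import numFieldNormedType.Exports.

Local Open Scope classical_set_scope.
Local Open Scope ring_scope.
Local Open Scope complex_scope.

(* The norm of a normed module over R[i] takes its values in R[i] and these
   values are nonnegative reals, so that Re gives the norm in R. *)
Definition rnorm (R : realType) (V : normedModType R[i]) (x : V) : R :=
  complex.Re `|x|.

(* A Hilbert space is a complete normed module over R[i] with a dot product,
   linear in the first variable, that induces its norm. *)
Definition induces_norm (R : realType) (H : completeNormedModType R[i])
    (dot : {dot H for Num.conj}) : Prop :=
  forall x : H, `|x| ^+ 2 = dot x x.

Definition separable (T : topologicalType) : Prop :=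
  exists2 D : set T, countable D & dense D.

Definition infinite_dimensional (K : fieldType) (V : lmodType K) : Prop :=
  ~ exists (n : nat) (e : 'I_n -> V),
      forall x : V, exists c : 'I_n -> K, x = \sum_(i < n) c i *: e i.

(* This is the operator norm only for bounded T: by convention, sup is 0 on
   unbounded sets. *)
Definition opnorm (R : realType) (V : normedModType R[i]) (T : V -> V) : R :=
  sup [set rnorm (T x) | x in [set x : V | rnorm x <= 1]].

(* When T is linear and bounded, the Riesz representation theorem gives a
   unique such z, and the default value 0 is not used. *)
Definition adjoint (R : realType) (H : completeNormedModType R[i])
    (dot : {dot H for Num.conj}) (T : H -> H) (y : H) : H :=
  xget 0 [set z : H | forall x : H, dot (T x) y = dot x z].

Definition frame_bounds (R : realType) (H : completeNormedModType R[i])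
    (dot : {dot H for Num.conj}) (K : countType) (x_ : K -> H) (A B : R) :
    Prop :=
  forall x : H,
    ((A * rnorm x ^+ 2)%:E <=
       \esum_(k in [set: K]) (complex.Re `|dot x (x_ k)| ^+ 2)%:E)%E /\
    (\esum_(k in [set: K]) (complex.Re `|dot x (x_ k)| ^+ 2)%:E
       <= (B * rnorm x ^+ 2)%:E)%E.

Definition parseval_frame (R : realType) (H : completeNormedModType R[i])
    (dot : {dot H for Num.conj}) (K : countType) (x_ : K -> H) : Prop :=
  frame_bounds dot x_ 1 1.

(* Main.v *)
Require Import Defs.
From HB Require Import structures.
From mathcomp Require Import all_boot all_order all_algebra.
From mathcomp Require Import complex sesquilinear.
From mathcomp Require Import all_classical all_reals all_analysis.
From mathcomp Require Import ring lra.

Set Implicit Arguments.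
Unset Strict Implicit.
Unset Printing Implicit Defensive.

Import Order.TTheory GRing.Theory Num.Theory.
Import numFieldNormedType.Exports.

Local Open Scope classical_set_scope.
Local Open Scope ring_scope.

(** Write S for the adjoint of T. Since <x, T^n v> = <S^n x, v>, the frame sum
    of the orbits of the v_i at x is the sum over n of beta (S^n x), where
    beta y is the sum over i of |<y, v_i>|^2 ([orbit_sum]).

    Necessity. If that sum is |x|^2 for every x, then its tail from rank N on
    is the same sum taken at S^N x, hence equals |S^N x|^2. Tails of a
    convergent series of nonnegative terms are dominated by the whole sum and
    tend to 0, so S is a contraction with S^N x --> 0; and T is a contraction
    when S is one ([adjoint_contraction]).

    Sufficiency. If S is a contraction, then q x y = <x, y> - <S x, S y> is a
    positive semidefinite form below the inner product. It is enough to find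
    vectors v_k with q x x = beta x for all x: the frame sum then telescopes to
    |x|^2 - lim |S^n x|^2 = |x|^2. The textbook choice is v_k = D e_k, with D
    the positive square root of 1 - T S and (e_k) an orthonormal basis; here
    the square root is replaced by a Cholesky factorization of q along a dense
    sequence (d_k) ([psd_form_parseval]). One step subtracts from the current
    form q_k the rank-one form that makes d_k isotropic,
      q_(k+1) x y = q_k x y - q_k x d_k * q_k d_k y / q_k d_k d_k.
    The subtracted form at (x, x) is the squared modulus of a bounded linear
    functional of x, that is |<x, v_k>|^2 for some v_k by the Riesz
    representation theorem. After n steps d_0, ..., d_(n-1) are in the radical
    of q_n, so that for j < n
      0 <= q_n x x = q_n (x - d_j) (x - d_j) <= |x - d_j|^2,
    and the remainder tends to 0 by density.

    The Riesz theorem, which also gives the existence of the adjoint, is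
    obtained by minimizing the energy |x|^2 - 2 Re f(x) ([riesz]). *)

(** * Positive semidefinite sesquilinear forms *)

Definition psd_form (C : numClosedFieldType) (U : lmodType C)
    (q : U -> U -> C) :=
  [/\ forall y, scalar (q^~ y),
      forall x y, q x y = (q y x)^* & forall x, 0 <= q x x].

Section PsdForm.
Variables (C : numClosedFieldType) (U : lmodType C).
Implicit Types (q : U -> U -> C) (x y d e : U).

Lemma psd_formDl q x y z : psd_form q -> q (x + y) z = q x z + q y z.
Proof. by case=> lin _ _; have := lin z 1 x y; rewrite scale1r mul1r. Qed.

Lemma psd_formZl q a x z : psd_form q -> q (a *: x) z = a * q x z.
Proof.
case=> lin _ _; have q0 : q 0 z = 0.
  have := lin z 1 0 0; rewrite scale1r mul1r addr0 => /eqP.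
  by rewrite -subr_eq0 opprD addNKr oppr_eq0 => /eqP.
by have := lin z a x 0; rewrite !addr0 q0 addr0.
Qed.

Lemma psd_formDr q x y z : psd_form q -> q z (x + y) = q z x + q z y.
Proof.
move=> qP; have [_ herm _] := qP.
by rewrite herm psd_formDl// rmorphD/= -!herm.
Qed.

Lemma psd_formZr q a x z : psd_form q -> q z (a *: x) = a^* * q z x.
Proof.
move=> qP; have [_ herm _] := qP.
by rewrite herm psd_formZl// rmorphM/= -herm.
Qed.

Lemma psd_form_sqrB q a x d : psd_form q ->
  q (x - a *: d) (x - a *: d) =
  q x x - (a * (q x d)^* + a^* * q x d) + `|a| ^+ 2 * q d d.
Proof.
move=> qP; have [_ herm _] := qP.
rewrite -scaleNr psd_formDl// !psd_formDr// !psd_formZl// !psd_formZr//.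
by rewrite -herm normCK rmorphN/=; ring.
Qed.

(** If q d d = 0 but q x d <> 0, then q (x - t *: d) (x - t *: d) is affine
    and not constant along the real multiples t of q x d, hence negative
    somewhere. *)
Lemma psd_form_isotropic q x d : psd_form q -> q d d = 0 -> q x d = 0.
Proof.
move=> qP qd0; have [_ herm pos] := qP; apply/eqP/negP => /negP qxd0.
(* With t = s * q x d, the affine function takes the value - (q x x + 2). *)
pose s := (q x x + 1) / `|q x d| ^+ 2.
have p0 : 0 < `|q x d| ^+ 2 by rewrite exprn_gt0// normr_gt0.
have s0 : s^* = s.
  by apply/CrealP/ger0_real/divr_ge0; [rewrite addr_ge0|exact: ltW].
have := pos (x - (s * q x d) *: d).
rewrite psd_form_sqrB// qd0 mulr0 addr0 rmorphM/= s0 -!mulrA.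
rewrite [(q x d)^* * _]mulrC -!normCK mulVf ?gt_eqF// mulr1.
rewrite [X in 0 <= X](_ : _ = - (q x x + 2)); last by ring.
by rewrite oppr_ge0 => /le_gtF; rewrite ltr_wpDl.
Qed.

(** The Schur complement of q with respect to d. If q d d = 0,
    then q x d = 0 as well for q positive semidefinite, and the quotient,
    which is 0 as a quotient by 0, needs no special case. *)
Definition schur q d x y := q x y - q x d * q d y / q d d.

Lemma schurE q d x : psd_form q ->
  schur q d x x = q x x - `|q x d| ^+ 2 / q d d.
Proof. by case=> _ herm _; rewrite /schur (herm d x) normCK. Qed.

(** Completing the square: [schur q d x x] is the minimum of q on the line of
    the vectors x - a *: d. *)
Lemma schur_ge0 q d x : psd_form q -> 0 <= schur q d x x.
Proof.
move=> qP; have [_ herm pos] := qP.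
have [qd0|qd0] := eqVneq (q d d) 0.
  by rewrite /schur qd0 invr0 mulr0 subr0.
have := pos (x - (q x d / q d d) *: d); rewrite psd_form_sqrB//.
congr (_ <= _); rewrite schurE// normrM exprMn.
rewrite (ger0_norm (x := (q d d)^-1)) ?invr_ge0//.
rewrite rmorphM fmorphV/= -[(q d d)^*]herm !normCK.
by field.
Qed.

Lemma schur_le q d x : psd_form q -> schur q d x x <= q x x.
Proof.
move=> qP; have [_ _ pos] := qP.
by rewrite schurE// gerBl divr_ge0// exprn_ge0.
Qed.

Lemma psd_form_CauchySchwarz q x d : psd_form q ->
  `|q x d| ^+ 2 <= q x x * q d d.
Proof.
move=> qP; have [_ _ pos] := qP.
have [qd0|qd0] := eqVneq (q d d) 0.
  by rewrite psd_form_isotropic// normr0 expr0n qd0 mulr0.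
rewrite -ler_pdivrMr ?lt_def ?qd0 ?pos// -subr_ge0 -schurE//.
exact: schur_ge0.
Qed.

Lemma schur_psd q d : psd_form q -> psd_form (schur q d).
Proof.
move=> qP; have [lin herm pos] := qP; split.
- move=> y a u v; rewrite /schur/= !lin; ring.
- move=> x y; rewrite /schur rmorphB !rmorphM fmorphV/= -!herm.
  by congr (_ - _ / _); rewrite mulrC.
- by move=> x; exact: schur_ge0.
Qed.

Lemma schur_pivot q d x : psd_form q -> schur q d x d = 0.
Proof.
move=> qP; rewrite /schur; have [qd0|qd0] := eqVneq (q d d) 0.
  by rewrite psd_form_isotropic// !mul0r subr0.
by rewrite mulfK// subrr.
Qed.

Lemma schur_radical q d e : (forall x, q x e = 0) ->
  forall x, schur q d x e = 0.
Proof. by move=> qe x; rewrite /schur !qe mulr0 mul0r subr0. Qed.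

Fixpoint schur_iter q (d : nat -> U) n :=
  if n is m.+1 then schur (schur_iter q d m) (d m) else q.

Variables (q : U -> U -> C) (d : nat -> U).
Hypothesis qP : psd_form q.
Local Notation q_ := (schur_iter q d).

Lemma schur_iter_psd n : psd_form (q_ n).
Proof. by elim: n => //= n IHn; exact: schur_psd. Qed.

Lemma schur_iter_le n x : q_ n x x <= q x x.
Proof.
elim: n => //= n IHn; apply: le_trans IHn; apply: schur_le.
exact: schur_iter_psd.
Qed.

Lemma schur_iter_radical n j x : (j < n)%N -> q_ n x (d j) = 0.
Proof.
elim: n x => // n IHn x; rewrite ltnS leq_eqVlt => /predU1P[->|jn] /=.
  exact/schur_pivot/schur_iter_psd.
by apply: schur_radical => z; exact: IHn.
Qed.

Lemma schur_iter_sum n x :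
  \sum_(0 <= k < n) `|q_ k x (d k)| ^+ 2 / q_ k (d k) (d k) =
  q x x - q_ n x x.
Proof.
elim: n => [|n IHn]; first by rewrite big_nil subrr.
rewrite big_nat_recr//= IHn schurE; last exact: schur_iter_psd.
by ring.
Qed.

(** The remainder after n steps only depends on x modulo the radical of the
    n-th form, which contains d j. *)
Lemma schur_iter_dist n j x : (j < n)%N ->
  q_ n x x <= q (x - d j) (x - d j).
Proof.
move=> jn; apply: le_trans (schur_iter_le n _).
have nP := schur_iter_psd n; have [_ herm _] := nP.
rewrite -[d j]scale1r psd_form_sqrB// !schur_iter_radical//.
by rewrite rmorph0 !mulr0 !addr0 oppr0 addr0.
Qed.

End PsdForm.

(** * Hilbert spaces and the Riesz representation theorem *)

Section Hilbert.
Variables (R : realType) (H : completeNormedModType R[i]).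
Variables (dot : {dot H for Num.conj}) (dot_norm : induces_norm dot).
Local Open Scope complex_scope.
(* Reopened so that z^* keeps denoting Num.conj. *)
Local Open Scope ring_scope.
Local Notation nrm z := (complex.Re `|z|).

Lemma RRe_norm (z : R[i]) : (nrm z)%:C = `|z|.
Proof. exact/RRe_real/normr_real. Qed.

Lemma rnormE (V : normedModType R[i]) (x : V) : `|x| = (rnorm x)%:C.
Proof. by rewrite /rnorm RRe_real// normr_real. Qed.

Lemma rnorm_ge0 (V : normedModType R[i]) (x : V) : 0 <= rnorm x.
Proof. by rewrite -ler0c -rnormE. Qed.

Lemma dotxx x : dot x x = (rnorm x ^+ 2)%:C.
Proof. by rewrite -dot_norm rnormE rmorphXn. Qed.

Lemma dot_psd : psd_form dot.
Proof.
split=> [y a u v|x y|x].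
- by rewrite linearPl.
- by rewrite hermC /= expr0 mul1r.
- by rewrite dotxx ler0c sqr_ge0.
Qed.

Lemma nrmX2 (z : R[i]) : (nrm z ^+ 2)%:C = `|z| ^+ 2.
Proof. by rewrite rmorphXn/= RRe_norm. Qed.

Lemma nrmD_sqr (z w : R[i]) : nrm (z + w) ^+ 2 <= 2 * (nrm z ^+ 2 + nrm w ^+ 2).
Proof.
have nge0 (x : R[i]) : 0 <= nrm x by rewrite -ler0c RRe_norm.
have : nrm (z + w) <= nrm z + nrm w.
  by rewrite -lecR rmorphD/= !RRe_norm ler_normD.
move=> /(lerXn2r 2 (nge0 _) (addr_ge0 (nge0 _) (nge0 _)))/le_trans; apply.
by rewrite -subr_ge0 (_ : _ - _ = (nrm z - nrm w) ^+ 2) ?sqr_ge0//; ring.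
Qed.

Lemma nrm_dot_le x y : nrm (dot x y) ^+ 2 <= rnorm x ^+ 2 * rnorm y ^+ 2.
Proof.
rewrite -lecR nrmX2 rmorphM/= -!dotxx.
exact: psd_form_CauchySchwarz dot_psd.
Qed.

Lemma dot_inj y z : (forall x, dot x y = dot x z) -> y = z.
Proof.
move=> yz; apply/eqP; rewrite -subr_eq0 -normr_eq0 -sqrf_eq0 dot_norm.
by rewrite linearBr /= yz subrr.
Qed.

Lemma cvg_rnorm0 (u : nat -> H) :
  u n @[n --> \oo] --> (0 : H) <-> rnorm (u n) ^+ 2 @[n --> \oo] --> (0 : R).
Proof.
split=> [/cvgr0Pnorm_lt u0|/cvgr0Pnorm_lt u0]; apply/cvgr0Pnorm_lt => e e0.
- have se0 : 0 < (Num.sqrt e)%:C by rewrite ltcR sqrtr_gt0.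
  near=> n; rewrite ger0_norm ?sqr_ge0//.
  rewrite -(sqr_sqrtr (ltW e0)) ltr_pXn2r ?nnegrE ?rnorm_ge0 ?sqrtr_ge0//.
  by rewrite -ltcR -rnormE; near: n; exact: u0.
- have [/eqP ime ree] : complex.Im e == 0 /\ 0 < complex.Re e.
    by move: e0; rewrite ltcE/= => /andP.
  near=> n; rewrite rnormE ltcE/= ime eqxx/=.
  rewrite -(@ltr_pXn2r _ 2)// ?nnegrE ?rnorm_ge0 ?(ltW ree)//.
  rewrite -[ltLHS]ger0_norm ?sqr_ge0//; near: n; apply: u0.
  by rewrite exprn_gt0.
Unshelve. all: by end_near. Qed.

Lemma cauchy_rnorm (u : nat -> H) :
  (forall e : R, 0 < e -> exists N, forall n : nat,
     (N <= n)%N -> rnorm (u N - u n) ^+ 2 < e) ->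
  cvgn u.
Proof.
move=> uC; apply/cauchy_cvgP/cauchy_exP => e e0.
have [/eqP ime ree] : complex.Im e == 0 /\ 0 < complex.Re e.
  by move: e0; rewrite ltcE/= => /andP.
have [N {}uC] := uC _ (exprn_gt0 2 ree).
exists (u N); exists N => // n /= Nn.
rewrite -ball_normE/= rnormE ltcE/= ime eqxx/=.
by rewrite -(@ltr_pXn2r _ 2)// ?nnegrE ?rnorm_ge0 ?(ltW ree)// uC.
Qed.

(** The real part is there only to have a value in [R]: the expression is real,
    equal to |x|^2 - 2 Re (f x). *)
Definition energy (f : H -> R[i]) (x : H) : R :=
  complex.Re (dot x x - (f x + (f x)^*)).

Lemma energyE (f : H -> R[i]) x :
  (energy f x)%:C = dot x x - (f x + (f x)^*).
Proof.
rewrite /energy dotxx; apply/RRe_real/CrealP.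
rewrite rmorphB rmorphD/= conjCK [f x + _]addrC; congr (_ - _).
exact: conjc_real.
Qed.

Lemma energy_subZ (f : H -> R[i]) a x d : scalar f ->
  (energy f (x - a *: d))%:C = (energy f x)%:C
   - (a * (dot x d - (f d)^*)^* + a^* * (dot x d - (f d)^*))
   + `|a| ^+ 2 * dot d d.
Proof.
move=> flin; rewrite !energyE psd_form_sqrB; last exact: dot_psd.
have -> : f (x - a *: d) = f x - a * f d.
  by rewrite -scaleNr addrC flin mulNr addrC.
rewrite !rmorphB !rmorphM/= conjCK; ring.
Qed.

(** An approximate Euler equation: moving x along d to the minimum of the
    energy on that line gains the left-hand side divided by |d|^2, and no more
    than [energy f x - m] can be gained. *)
Lemma energy_residual (f : H -> R[i]) (m : R) x d : scalar f ->
  (forall y, m <= energy f y) ->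
  nrm (dot x d - (f d)^*) ^+ 2 <= (energy f x - m) * rnorm d ^+ 2.
Proof.
move=> flin fm; set g := dot x d - (f d)^*.
have [d0|d0] := eqVneq (dot d d) 0.
  have /eqP : `|d| ^+ 2 = 0 by rewrite dot_norm.
  rewrite sqrf_eq0 normr_eq0 => /eqP dE.
  have f0 : f 0 = 0.
    by have := flin (-1) 0 0; rewrite scaler0 addr0 mulN1r addNr.
  have -> : g = 0 by rewrite /g dE linear0r f0 rmorph0 subr0.
  by rewrite /rnorm dE !normr0 /= expr0n mulr0.
have dC : (dot d d)^* = dot d d by have [_ <-] := dot_psd.
have : m%:C <= (energy f (x - (g / dot d d) *: d))%:C by rewrite lecR.
rewrite energy_subZ// -/g.
rewrite -lecR nrmX2 [X in _ -> _ <= X]rmorphM.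
rewrite [X in _ -> _ <= X * _]rmorphB/= -dotxx.
rewrite -ler_pdivrMr; last by rewrite lt_def d0 dotxx ler0c sqr_ge0.
rewrite [X in _ <= X -> _](_ : _ = (energy f x)%:C - `|g| ^+ 2 / dot d d).
  by rewrite lerBrDl lerBrDr.
rewrite normrM exprMn (ger0_norm (x := (dot d d)^-1)); last first.
  by rewrite invr_ge0 dotxx ler0c sqr_ge0.
by rewrite rmorphM fmorphV/= dC !normCK; field.
Qed.

(** The Riesz representation theorem, by minimization of the energy. Applied to
    the difference d of two terms of a minimizing sequence u, the approximate
    Euler equations bound |d|^2, so u converges; at the limit z they become
    exact, <z, d> = (f d)^* for all d. *)
Lemma riesz (f : H -> R[i]) (M : R) : scalar f -> 0 <= M ->
  (forall x, nrm (f x) ^+ 2 <= M * rnorm x ^+ 2) ->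
  exists z, forall x, f x = dot x z.
Proof.
move=> flin M0 fM.
have lbF : has_lbound (range (energy f)).
  exists (- M) => _ [x _ <-]; rewrite /energy dotxx /=.
  have le1 : `|complex.Re (f x)| <= nrm (f x).
    by rewrite -lecR RRe_norm normc_ge_Re.
  rewrite (_ : complex.Re _ = rnorm x ^+ 2 - 2 * complex.Re (f x)); last first.
    by rewrite !raddfB !raddfD/=; case: (f x) => a b /=; ring.
  have {}le1 : complex.Re (f x) ^+ 2 <= M * rnorm x ^+ 2.
    apply: le_trans (fM x); rewrite -real_normK ?num_real//.
    by rewrite lerXn2r ?nnegrE// (le_trans _ le1).
  (* 4 (Re (f x))^2 <= 4 M |x|^2 <= (|x|^2 + M)^2 *)
  have s0 : 0 <= rnorm x ^+ 2 + M by rewrite addr_ge0 ?sqr_ge0.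
  rewrite lerNl opprB lerBlDr addrC (le_trans (ler_norm _))//.
  rewrite -(@ler_pXn2r _ 2)// ?nnegrE// real_normK ?num_real//.
  move: le1; set a := complex.Re _; set r := rnorm x ^+ 2 => le1.
  rewrite -subr_ge0 [X in 0 <= X](_ : _ = (r - M) ^+ 2 + 4 * (M * r - a ^+ 2)).
    by rewrite addr_ge0 ?sqr_ge0// mulr_ge0// subr_ge0.
  by ring.
have iF : has_inf (range (energy f)) by split=> //; exists (energy f 0), 0.
pose m := inf (range (energy f)).
have mF y : m <= energy f y by apply: ge_inf => //; exists y.
have /choice[u uP] : forall n, exists x, energy f x < m + n.+1%:R^-1.
  move=> n; have n0 : 0 < n.+1%:R^-1 :> R by rewrite invr_gt0 ltr0n.
  have [_ [x _ <-] xm] := inf_adherent n0 iF.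
  by exists x.
have res n d : nrm (dot (u n) d - (f d)^*) ^+ 2 <= n.+1%:R^-1 * rnorm d ^+ 2.
  apply: le_trans (energy_residual (u n) d flin mF) _.
  by rewrite ler_wpM2r ?sqr_ge0// lerBlDl ltW.
have uC N n : (N <= n)%N -> rnorm (u N - u n) ^+ 2 <= 4 * N.+1%:R^-1.
  move=> Nn; set d := u N - u n.
  have [d0|d0] := eqVneq (rnorm d ^+ 2) 0; first by rewrite d0 mulr_ge0.
  rewrite -(@ler_pM2r _ (rnorm d ^+ 2)); last by rewrite lt_def d0 sqr_ge0.
  have {1 2}-> : rnorm d ^+ 2 = nrm (dot d d).
    by rewrite dotxx ger0_norm// ler0c sqr_ge0.
  rewrite -expr2.
  have -> : dot d d = (dot (u N) d - (f d)^*) + - (dot (u n) d - (f d)^*).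
    by rewrite {1}/d linearBl/=; ring.
  apply: le_trans (nrmD_sqr _ _) _.
  have := res N d; have := res n d; rewrite normrN => resn resN.
  have nN : n.+1%:R^-1 * rnorm d ^+ 2 <= N.+1%:R^-1 * rnorm d ^+ 2.
    by rewrite ler_wpM2r ?sqr_ge0// lef_pV2 ?posrE ?ltr0n// ler_nat.
  rewrite -mulrA; move: nN resN resn; move: (_ * _) (_ * _) => a b.
  by move: (nrm _ ^+ 2) (nrm _ ^+ 2) => a' b'; lra.
have /cvg_ex[/= z uz] : cvgn u.
  apply: cauchy_rnorm => e e0; have e4 : 0 < e / 4 by rewrite divr_gt0.
  have [N _ /(_ N (leqnn N)) Ne] := near_infty_natSinv_lt (PosNum e4).
  exists N => n /uC /le_lt_trans; apply.
  by move: Ne; rewrite /= ltr_pdivlMr// mulrC.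
exists z => x; apply/eqP; rewrite -subr_eq0.
set w := dot z x - (f x)^*.
have -> : f x - dot x z = - w^*.
  by have [_ herm _] := dot_psd; rewrite /w rmorphB/= -herm conjCK opprB.
have zu : rnorm (z - u n) ^+ 2 @[n --> \oo] --> (0 : R).
  by apply/cvg_rnorm0; rewrite -(subrr z); apply: cvgB uz; exact: cvg_cst.
have lim0 : 2 * rnorm x ^+ 2 * (rnorm (z - u n) ^+ 2 + n.+1%:R^-1)
    @[n --> \oo] --> (2 * rnorm x ^+ 2 * (0 + 0) : R).
  by apply: cvgMr; apply: cvgD => //; exact: cvg_harmonic.
have : nrm w ^+ 2 <= 2 * rnorm x ^+ 2 * (0 + 0).
  apply: cvgr_to_ge lim0 _; apply: nearW => n.
  have -> : w = dot (z - u n) x + (dot (u n) x - (f x)^*).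
    by rewrite /w linearBl/=; ring.
  move/(lerD (nrm_dot_le (z - u n) x)): (res n x).
  rewrite -mulrDl -(ler_pM2l (ltr0n R 2)) [X in _ <= 2 * X -> _]mulrC mulrA.
  by apply: le_trans; exact: nrmD_sqr.
rewrite addr0 mulr0 -lecR nrmX2 => w0.
have : `|w| ^+ 2 == 0 by rewrite eq_le w0 exprn_ge0.
by rewrite sqrf_eq0 normr_eq0 oppr_eq0 fmorph_eq0.
Qed.

(** * Cholesky factorization of a form below the inner product *)

Lemma separable_seq : separable H ->
  exists d : nat -> H, forall x (e : R), 0 < e ->
    exists j, rnorm (x - d j) ^+ 2 < e.
Proof.
move=> [D cD dD].
have /pcard_surjP[d dP] := cD.
exists d => x e e0.
have [y [xy /dP[j _ jy]]] : ball x (Num.sqrt e)%:C `&` D !=set0.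
  have e1 : 0 < (Num.sqrt e)%:C by rewrite ltcR sqrtr_gt0.
  by apply: dD; [exists x; exact: ballxx|exact: ball_open].
exists j; rewrite jy.
move: xy; rewrite -ball_normE/= rnormE ltcR.
rewrite -(@ltr_pXn2r _ 2) ?nnegrE ?rnorm_ge0 ?sqrtr_ge0//.
by rewrite sqr_sqrtr// ltW.
Qed.

(** The vector v k represents the functional
    x |-> q_k x (d k) / sqrt (q_k (d k) (d k)), where q_k is the k-th iterated
    Schur complement; Cauchy-Schwarz for q_k bounds this functional by 1. *)
Lemma psd_form_parseval (q : H -> H -> R[i]) : separable H -> psd_form q ->
  (forall x, q x x <= dot x x) ->
  exists v : nat -> H, forall x,
    (\esum_(k in [set: nat]) (nrm (dot x (v k)) ^+ 2)%:E =
     (complex.Re (q x x))%:E)%E.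
Proof.
move=> /separable_seq[d dP] qP q_le.
pose p k x := schur_iter q d k x (d k) / sqrtC (schur_iter q d k (d k) (d k)).
have pE k x : `|p k x| ^+ 2 =
    `|schur_iter q d k x (d k)| ^+ 2 / schur_iter q d k (d k) (d k).
  have [_ _ pos] := schur_iter_psd d qP k.
  rewrite normrM exprMn normfV exprVn.
  by rewrite [`|sqrtC _|]ger0_norm ?sqrtC_ge0// sqrtCK.
have /choice[v vP] : forall k, exists z, forall x, p k x = dot x z.
  move=> k; apply: (@riesz _ 1) => //.
    move=> a x y; have [lin _ _] := schur_iter_psd d qP k.
    by rewrite /p lin mulrDl mulrA.
  move=> x; rewrite mul1r -lecR nrmX2 -dotxx pE.
  apply: le_trans (q_le x); apply: le_trans (schur_iter_le d qP k x).
  have kP := schur_iter_psd d qP k; have [_ _ pos] := kP.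
  have := psd_form_CauchySchwarz x (d k) kP.
  have [->|d0] := eqVneq (schur_iter q d k (d k) (d k)) 0.
    by rewrite invr0 !mulr0 => _; exact: pos.
  by rewrite ler_pdivrMr// lt_def d0 pos.
exists v => x.
have qr n : schur_iter q d n x x = (complex.Re (schur_iter q d n x x))%:C.
  by apply/esym/RRe_real/ger0_real; have [_ _] := schur_iter_psd d qP n.
have sumE n : \sum_(0 <= k < n) nrm (dot x (v k)) ^+ 2 =
    complex.Re (q x x) - complex.Re (schur_iter q d n x x).
  apply: complexI; rewrite rmorphB/= -qr -(qr 0%N)/= -schur_iter_sum//.
  rewrite rmorph_sum; apply: eq_bigr => k _.
  by rewrite -[LHS]/((_ ^+ 2)%:C) nrmX2 -vP pE.
rewrite -nneseries_esumT; last by move=> k; rewrite lee_fin sqr_ge0.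
apply/cvg_lim => //; under eq_fun do rewrite sumEFin sumE.
apply: cvg_EFin; first exact: nearW.
apply/cvgrPdist_lt => e e0; have [j xj] := dP x e e0.
near=> n.
have jn : (j < n)%N by near: n; exists j.+1.
rewrite /= opprB addrC subrK ger0_norm.
  apply: le_lt_trans xj; rewrite -lecR -qr -dotxx.
  by apply: le_trans (q_le _); exact: schur_iter_dist.
by rewrite -lecR -qr; have [_ _] := schur_iter_psd d qP n.
Unshelve. all: by end_near. Qed.

(** * Adjoints and contractions *)

Lemma adjointP (T : {linear H -> H}) x y : bounded_near T (nbhs (0 : H)) ->
  dot (T x) y = dot x (adjoint dot T y).
Proof.
move=> /linear_boundedP/pinfty_ex_gt0[M M0 TM].
have [Me Me0] : M = (complex.Re M)%:C /\ 0 < complex.Re M.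
  have /esym ME := RRe_real (gtr0_real M0); split=> //.
  by move: M0; rewrite {1}ME ltcR.
have TMr z : rnorm (T z) <= complex.Re M * rnorm z.
  by rewrite -lecR rmorphM/= -Me -!rnormE.
rewrite /adjoint; case: xgetP => [z _ -> //|noz].
have [|||z zP] := @riesz (fun u => dot (T u) y)
    (complex.Re M ^+ 2 * rnorm y ^+ 2).
- by move=> a u v; rewrite linearP linearPl.
- by rewrite mulr_ge0 ?sqr_ge0.
- move=> u; apply: le_trans (nrm_dot_le _ _) _.
  rewrite [leRHS]mulrAC ler_wpM2r ?sqr_ge0// -exprMn.
  rewrite lerXn2r ?nnegrE ?rnorm_ge0//.
  by rewrite mulr_ge0 ?rnorm_ge0 ?ltW.
- by case: (noz z).
Qed.

(** Stated for any pair of functions in duality, so that it transfers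
    contractivity from T to its adjoint and back. *)
Lemma adjoint_contraction (A B : H -> H) :
  (forall x y, dot (A x) y = dot x (B y)) ->
  (forall x, rnorm (A x) <= rnorm x) -> forall y, rnorm (B y) <= rnorm y.
Proof.
move=> AB Ale y; have := nrm_dot_le (A (B y)) y.
rewrite AB dotxx// ger0_norm ?ler0c ?sqr_ge0//= => By.
have [->|B0] := eqVneq (rnorm (B y)) 0; first exact: rnorm_ge0.
rewrite -(@ler_pXn2r _ 2) ?nnegrE ?rnorm_ge0//.
rewrite -(@ler_pM2l _ (rnorm (B y) ^+ 2)); last first.
  by rewrite lt_def sqrf_eq0 B0 sqr_ge0.
rewrite -expr2; apply: le_trans By _.
by rewrite ler_wpM2r ?sqr_ge0// lerXn2r ?nnegrE ?rnorm_ge0.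
Qed.

(** Boundedness makes the set in the definition of [opnorm] bounded above, so
    that its supremum is not a default value. *)
Lemma opnorm_le1 (T : {linear H -> H}) : bounded_near T (nbhs (0 : H)) ->
  opnorm T <= 1 <-> forall x, rnorm (T x) <= rnorm x.
Proof.
move=> /linear_boundedP/pinfty_ex_gt0[M M0 TM]; split=> [T1 x|Tle].
  have [x0|x0] := eqVneq x 0.
    by rewrite x0 linear0.
  have nx0 : 0 < rnorm x by rewrite -ltcR -rnormE normr_gt0.
  have ub : has_ubound [set rnorm (T x) | x in [set x : H | rnorm x <= 1]].
    exists (complex.Re M) => _ [z /= z1 <-].
    rewrite -lecR (RRe_real (gtr0_real M0)) -rnormE (le_trans (TM z))//.
    by rewrite ler_piMr ?(ltW M0)// rnormE -[leRHS]/(1%:C) lecR.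
  pose c : R[i] := ((rnorm x)^-1)%:C.
  have rZ z : rnorm (c *: z) = (rnorm x)^-1 * rnorm z.
    apply: complexI; rewrite -rnormE normrZ rnormE rmorphM/= ger0_norm//.
    by rewrite ler0c invr_ge0 ltW.
  have : rnorm (T (c *: x)) <= opnorm T.
    by apply: ub_le_sup => //; exists (c *: x) => //=; rewrite rZ mulVf ?gt_eqF.
  move=> /le_trans/(_ T1); rewrite linearZ/= rZ mulrC ler_pdivrMr//.
  by rewrite mul1r.
apply: ge_sup; first by exists (rnorm (T 0)), 0 => //=; rewrite /rnorm normr0.
by move=> _ [x /= x1 <-]; exact: le_trans (Tle x) x1.
Qed.

(** * Parseval frames of orbits *)

Lemma parsevalP (K : countType) (x_ : K -> H) :
  parseval_frame dot x_ <-> forall x,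
    (\esum_(k in [set: K]) (nrm (dot x (x_ k)) ^+ 2)%:E = (rnorm x ^+ 2)%:E)%E.
Proof.
split=> [P x|P x].
  by have [] := P x; rewrite mul1r => le1 le2; apply/eqP; rewrite eq_le le2.
by rewrite P mul1r.
Qed.

Lemma orbit_sum (T S : H -> H) (I : countType) (v : I -> H) x :
  (forall x y, dot (T x) y = dot x (S y)) ->
  (\esum_(k in [set: I * nat])
     (nrm (dot x (iter k.2 T (v k.1))) ^+ 2)%:E =
   \sum_(n <oo) \esum_(i in [set: I]) (nrm (dot (iter n S x) (v i)) ^+ 2)%:E)%E.
Proof.
move=> TS; have [_ herm _] := dot_psd.
have iterS n y : dot x (iter n T y) = dot (iter n S x) y.
  elim: n x => // n IHn z.
  by rewrite [iter _ S z]iterSr -IHn [LHS]herm TS -herm.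
rewrite nneseries_esumT; last first.
  by move=> n; apply: esum_ge0 => i _; rewrite lee_fin sqr_ge0.
rewrite esum_esum; last by move=> n i _ _; rewrite lee_fin sqr_ge0.
pose sw (k : nat * I) := (k.2, k.1).
have sw_bij : set_bij ([set: nat] `*`` (fun=> [set: I])) [set: I * nat] sw.
  split=> //; first by move=> [n i] [m j] _ _ [-> ->].
  by move=> [i n] _; exists (n, i).
rewrite (@reindex_esum _ _ _ _ _ sw _ sw_bij).
by apply: eq_esum => k _ /=; rewrite iterS.
Qed.

(** The tail from rank N on of the series for x is the series for S^N x. *)
Lemma parseval_orbit_necessary (T S : H -> H) (I : countType) (v : I -> H) :
  (forall x y, dot (T x) y = dot x (S y)) ->
  parseval_frame dot (fun k : I * nat => iter k.2 T (v k.1)) ->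
  (forall x, rnorm (S x) <= rnorm x) /\
  forall x, iter n S x @[n --> \oo] --> (0 : H).
Proof.
move=> TS /parsevalP P.
pose b n x := (\esum_(i in [set: I]) (nrm (dot (iter n S x) (v i)) ^+ 2)%:E)%E.
have b0 n x : (0 <= b n x)%E.
  by apply: esum_ge0 => i _; rewrite lee_fin sqr_ge0.
have bsum x : (\sum_(n <oo) b n x = (rnorm x ^+ 2)%:E)%E.
  by rewrite -P (orbit_sum _ _ TS).
have tail N x : (\sum_(N <= n <oo) b n x = (rnorm (iter N S x) ^+ 2)%:E)%E.
  rewrite -bsum -nneseries_addn//; apply: eq_eseriesr => n _.
  by rewrite /b iterD.
split=> x.
  rewrite -(@ler_pXn2r _ 2) ?nnegrE ?rnorm_ge0// -lee_fin -(tail 1%N) -bsum.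
  by rewrite [leRHS]nneseries_recl// leeDr.
apply/cvg_rnorm0.
have := @nneseries_tail_cvg _ (b ^~ x) predT.
rewrite bsum ltry => /(_ isT (fun n _ => b0 n x)).
under eq_fun do rewrite tail.
by move=> /fine_cvg.
Qed.

(** The vectors v factor the defect form of S, so the series for x is the
    telescoping series of the |S^n x|^2 - |S^(n+1) x|^2. *)
Lemma parseval_orbit_sufficient (T S : H -> H) : separable H ->
  (forall x y, dot (T x) y = dot x (S y)) ->
  (forall x, rnorm (S x) <= rnorm x) ->
  (forall x, iter n S x @[n --> \oo] --> (0 : H)) ->
  exists v : nat -> H,
    parseval_frame dot (fun k : nat * nat => iter k.2 T (v k.1)).
Proof.
move=> sepH TS Sle S0; pose q x y := dot x y - dot (S x) (S y).
have dP := dot_psd; have [_ herm _] := dP.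
have Slin a x y : S (a *: x + y) = a *: S x + S y.
  apply: dot_inj => z.
  by rewrite -TS !psd_formDr// !psd_formZr// -!TS.
have qP : psd_form q.
  split=> [y a u w|x y|x].
  - by rewrite /q Slin !linearPl/=; ring.
  - by rewrite /q rmorphB/= -!herm.
  - by rewrite /q subr_ge0 !dotxx// lecR lerXn2r ?nnegrE ?rnorm_ge0.
have q_le x : q x x <= dot x x.
  by rewrite /q gerBl dotxx// ler0c sqr_ge0.
have [v vq] := psd_form_parseval sepH qP q_le.
exists v; apply/parsevalP => x; rewrite (orbit_sum _ _ TS).
have qE n : complex.Re (q (iter n S x) (iter n S x)) =
    rnorm (iter n S x) ^+ 2 - rnorm (iter n.+1 S x) ^+ 2.
  by rewrite /q !dotxx.
under eq_eseriesr do rewrite vq qE.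
apply/cvg_lim => //.
have sumE n : \sum_(0 <= k < n)
    (rnorm (iter k S x) ^+ 2 - rnorm (iter k.+1 S x) ^+ 2)
    = rnorm x ^+ 2 - rnorm (iter n S x) ^+ 2.
  rewrite (@telescope_sumr_eq _ 0%N n (fun k => - rnorm (iter k S x) ^+ 2))//.
    by rewrite opprK addrC.
  by move=> k _; rewrite opprK addrC.
under eq_fun do rewrite sumEFin sumE.
apply: cvg_EFin; first exact: nearW.
rewrite -[X in _ --> X]subr0; apply: cvgB; first exact: cvg_cst.
exact/cvg_rnorm0.
Qed.

End Hilbert.

Local Open Scope complex_scope.

Theorem theorem1p1 (R : realType) (H : completeNormedModType R[i])
    (dot : {dot H for Num.conj}) (dot_norm : induces_norm dot)
    (H_separable : separable H) (H_infinite : infinite_dimensional H)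
    (T : {linear H -> H}) (T_bounded : bounded_near T (nbhs (0 : H))) :
  (exists (I : countType) (v : I -> H),
     parseval_frame dot (fun k : I * nat => iter k.2 T (v k.1))) <->
  (opnorm T <= 1 /\
   forall v : H, iter n (adjoint dot T) v @[n --> \oo] --> (0 : H)).
Proof.
have TS x y : dot (T x) y = dot x (adjoint dot T y) by exact: adjointP.
have [_ herm _] := dot_psd dot_norm.
have ST x y : dot (adjoint dot T x) y = dot x (T y).
  by rewrite herm -TS -herm.
split=> [[I [v /(parseval_orbit_necessary dot_norm TS)[Sle S0]]]|[T1 S0]].
  by split=> //; apply/(opnorm_le1 T_bounded); exact: adjoint_contraction Sle.
exists nat.
apply: (parseval_orbit_sufficient dot_norm H_separable TS) => //.
by apply: adjoint_contraction TS _ => //; apply/opnorm_le1.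
Qed.
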